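(* Let $f:\mathbb{R}^n\times\mathbb{R}^p\to\mathbb{R}$ be continuously differentiable with $L$-Lipschitz gradient, $\mu_x$-strongly convex in $x$ and $\mu_y$-strongly concave in $y$ (in the precise sense given in the context), with $L\ge\mu_x\ge\mu_y>0$, and let $(x^\star,y^\star)$ be its unique saddle point. Let $h,\rho,\alpha$ be real parameters satisfying $$0<h\le \frac{2}{15L},\qquad \rho=\frac{h\mu_x}{8},\qquad \frac{4}{4+h\sqrt{\mu_x\mu_y}}\le \alpha\le \frac{8}{8+h\sqrt{\mu_x\mu_y}}.$$ Let $(x_t,y_t,v_t)_{t\ge0}$ be generated by the PCE-DM iteration (defined in the context) from an arbitrary initial point $(x_0,y_0)\in\mathbb{R}^n\times\mathbb{R}^p$ with $v_0=0$, and put $D_t:=\lVert x_t-x^\star\rVert^2+\lVert y_t-y^\star\rVert^2$. Then, for every integer $T\ge0$, $$D_T\le \frac{32L^2}{\mu_y\sqrt{\mu_x\mu_y}}\left(1+\frac{h\sqrt{\mu_x\mu_y}}{16}\right)^{-T}D_0.$$ Consequently, for $0<\varepsilon<1$, any integer $T$ satisfying $$T\ge\frac{32}{h\sqrt{\mu_x\mu_y}}\log\frac{32L^2}{\mu_y\sqrt{\mu_x\mu_y}\,\varepsilon}$$ ensures $D_T\le\varepsilon D_0$.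
   Context: Norms and inner products are Euclidean; $\log$ is the natural logarithm. Assumptions on $f$: (i) $\lVert\nabla f(x',y')-\nabla f(x,y)\rVert\le L\lVert(x'-x,y'-y)\rVert$ for all $(x,y),(x',y')\in\mathbb{R}^n\times\mathbb{R}^p$, where $\nabla f=(\nabla_x f,\nabla_y f)$ is the full gradient; (ii) for all $x,x'\in\mathbb{R}^n$ and $y,y'\in\mathbb{R}^p$, $$f(x',y)\ge f(x,y)+\langle\nabla_x f(x,y),x'-x\rangle+\tfrac{\mu_x}{2}\lVert x'-x\rVert^2,$$ $$f(x,y')\le f(x,y)+\langle\nabla_y f(x,y),y'-y\rangle-\tfrac{\mu_y}{2}\lVert y'-y\rVert^2.$$ Under these assumptions $f$ has a unique saddle point $(x^\star,y^\star)$ (for $\min_x\max_y f$), and $\nabla f(x^\star,y^\star)=0$. PCE-DM iteration with parameters $h,\alpha,\rho$: given $(x_0,y_0)$ and $v_0=0$, for $t=0,1,2,\dots$ set $$\widetilde x_t=x_t-h\nabla_x f(x_t,y_t),\qquad \widetilde y_t=y_t+h\bigl(\nabla_y f(x_t,y_t)+v_t\bigr),$$ $$\widetilde v_t=\alpha v_t+\rho\nabla_y f(\widetilde x_t,\widetilde y_t),$$ $$x_{t+1}=x_t-h\nabla_x f(\widetilde x_t,\widetilde y_t),\qquad y_{t+1}=y_t+h\bigl(\nabla_y f(\widetilde x_t,\widetilde y_t)+\widetilde v_t\bigr),$$ $$v_{t+1}=\alpha v_t+\rho\nabla_y f(x_{t+1},y_{t+1}).$$ *)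

(* Defs.v *)
From mathcomp Require Import all_boot all_order all_algebra.
From mathcomp Require Import all_classical all_reals all_analysis.

Set Implicit Arguments.
Unset Strict Implicit.
Unset Printing Implicit Defensive.

Import Order.TTheory GRing.Theory Num.Theory.
Import numFieldNormedType.Exports.

Local Open Scope classical_set_scope.
Local Open Scope ring_scope.

Section euclidean.
Variables (R : realType) (n : nat).
Implicit Types u v : 'rV[R]_n.

Definition dotv u v : R := \sum_(i < n) u 0 i * v 0 i.

(* The library norm `|u| on 'rV[R]_n is the sup norm, so the Euclidean norm has
   to be defined; both norms induce the same topology and derivatives. *)
Definition enorm u : R := Num.sqrt (dotv u u).

End euclidean.

(* Euclidean norm of (u, v) in R^n x R^p = R^(n + p). *)
Definition enorm2 (R : realType) (n p : nat) (u : 'rV[R]_n) (v : 'rV[R]_p) : R :=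
  Num.sqrt (enorm u ^+ 2 + enorm v ^+ 2).

Section saddle.
Variables (R : realType) (n p : nat).
Variable f : 'rV[R]_n -> 'rV[R]_p -> R.

Definition gradx (x : 'rV[R]_n) (y : 'rV[R]_p) : 'rV[R]_n :=
  \row_(i < n) 'D_(delta_mx 0 i) (fun x' => f x' y) x.

Definition grady (x : 'rV[R]_n) (y : 'rV[R]_p) : 'rV[R]_p :=
  \row_(j < p) 'D_(delta_mx 0 j) (fun y' => f x y') y.

Definition continuously_differentiable : Prop :=
  [/\ forall z : 'rV[R]_n * 'rV[R]_p,
        differentiable (fun w : 'rV[R]_n * 'rV[R]_p => f w.1 w.2) z,
      continuous (fun w : 'rV[R]_n * 'rV[R]_p => gradx w.1 w.2) &
      continuous (fun w : 'rV[R]_n * 'rV[R]_p => grady w.1 w.2)].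

Definition lipschitz_gradient (L : R) : Prop :=
  forall (x x' : 'rV[R]_n) (y y' : 'rV[R]_p),
    enorm2 (gradx x' y' - gradx x y) (grady x' y' - grady x y) <=
    L * enorm2 (x' - x) (y' - y).

Definition strongly_convex_x (mux : R) : Prop :=
  forall (x x' : 'rV[R]_n) (y : 'rV[R]_p),
    f x' y >= f x y + dotv (gradx x y) (x' - x) + mux / 2 * enorm (x' - x) ^+ 2.

Definition strongly_concave_y (muy : R) : Prop :=
  forall (x : 'rV[R]_n) (y y' : 'rV[R]_p),
    f x y' <= f x y + dotv (grady x y) (y' - y) - muy / 2 * enorm (y' - y) ^+ 2.

Definition saddle_point (xs : 'rV[R]_n) (ys : 'rV[R]_p) : Prop :=
  forall (x : 'rV[R]_n) (y : 'rV[R]_p), f xs y <= f xs ys <= f x ys.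

Definition pce_dm (h alpha rho : R)
    (x : nat -> 'rV[R]_n) (y v : nat -> 'rV[R]_p) : Prop :=
  v 0%N = 0 /\
  forall t : nat,
    let xt := x t - h *: gradx (x t) (y t) in
    let yt := y t + h *: (grady (x t) (y t) + v t) in
    let vt := alpha *: v t + rho *: grady xt yt in
    [/\ x t.+1 = x t - h *: gradx xt yt,
        y t.+1 = y t + h *: (grady xt yt + vt) &
        v t.+1 = alpha *: v t + rho *: grady (x t.+1) (y t.+1)].

End saddle.

Definition sqdist (R : realType) (n p : nat)
    (x xs : 'rV[R]_n) (y ys : 'rV[R]_p) : R :=
  enorm (x - xs) ^+ 2 + enorm (y - ys) ^+ 2.

(* Main.v *)
(* With [gam = (1 / alpha - 1) / h] and [b = mux (1 + h gam) / 8], the momentum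
   update is the implicit step [v' - v = h (b grad_y f(x', y') - gam v')].
   Let [e], [d], [q] be [ecoef], [dcoef], [qcoef] below.  Writing [u = - grad_x f]
   and [w = grad_y f + v] for the velocities, the energy
     |u|^2/2 + |w|^2/2 - q (f - f(xs, ys))
       + d/2 |x - xs|^2 + e gam/2 |y - ys|^2 + e <v, y - ys>
   decreases by the factor [1 + h s / 16], [s = sqrt (mux muy)]: strong
   monotonicity of [(grad_x f, - grad_y f)] along a step bounds the increment of
   the kinetic part, up to the momentum force [<v' - v, w>]; convexity in [x] and
   concavity in [y] give an increment of [f] that trades this force against
   dissipation in [u] and [w]; and the three remaining terms turn the velocities
   into dissipation of the distance to the saddle point.  The extragradient
   corrector leaves a defect [- |(u, w) - (u~, w~)|^2 / 2] that absorbs all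
   discretization errors because [h L <= 2 / 15].  Finally the energy lies
   between [s^2 / 32] and (at [v = 0]) [L^2] times the squared distance. *)
Require Import Defs.
From mathcomp Require Import all_boot all_order all_algebra.
From mathcomp Require Import all_classical all_reals all_analysis.
From mathcomp Require Import ring lra.
Set Implicit Arguments.
Unset Strict Implicit.
Unset Printing Implicit Defensive.

Import Order.TTheory GRing.Theory Num.Theory.
Import numFieldNormedType.Exports.
Local Open Scope ring_scope.

(** * Euclidean inner product algebra *)

Section DotProduct.
Variables (R : realType) (n : nat).
Implicit Types (u v w : 'rV[R]_n) (k : R).

Lemma dotvC u v : dotv u v = dotv v u.
Proof. by apply: eq_bigr => i _; rewrite mulrC. Qed.

Lemma dotvDl u v w : dotv (u + v) w = dotv u w + dotv v w.
Proof. by rewrite -big_split; apply: eq_bigr => i _; rewrite mxE mulrDl. Qed.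

Lemma dotvDr u v w : dotv w (u + v) = dotv w u + dotv w v.
Proof. by rewrite dotvC dotvDl !(dotvC w). Qed.

Lemma dotvZl k u v : dotv (k *: u) v = k * dotv u v.
Proof. by rewrite [RHS]mulr_sumr; apply: eq_bigr => i _; rewrite mxE mulrA. Qed.

Lemma dotvZr k u v : dotv u (k *: v) = k * dotv u v.
Proof. by rewrite dotvC dotvZl dotvC. Qed.

Lemma dotv0l v : dotv 0 v = 0.
Proof. by rewrite -(scale0r v) dotvZl mul0r. Qed.

Lemma dotvNl u v : dotv (- u) v = - dotv u v.
Proof. by rewrite -scaleN1r dotvZl mulN1r. Qed.

Lemma dotvNr u v : dotv u (- v) = - dotv u v.
Proof. by rewrite dotvC dotvNl dotvC. Qed.

Lemma dotvB_swap u v : dotv (u - v) (u - v) = dotv (v - u) (v - u).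
Proof. by rewrite -(opprB v u) dotvNl dotvNr opprK. Qed.

Definition dotvE := (dotvDl, dotvDr, dotvZl, dotvZr, dotvNl, dotvNr).

Lemma dotv_ge0 u : 0 <= dotv u u.
Proof. by apply: sumr_ge0 => i _; rewrite -expr2 sqr_ge0. Qed.

Lemma dotv_eq0 u : dotv u u <= 0 -> u = 0.
Proof.
move=> u0; have /eqP : dotv u u = 0 by apply/eqP; rewrite eq_le u0 dotv_ge0.
rewrite psumr_eq0 => [/allP z|i _]; last by rewrite -expr2 sqr_ge0.
apply/rowP => i; rewrite mxE; have := z i (mem_index_enum i).
by rewrite /= -expr2 sqrf_eq0 => /eqP.
Qed.

Lemma enorm_sqr u : enorm u ^+ 2 = dotv u u.
Proof. by rewrite sqr_sqrtr // dotv_ge0. Qed.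

(** Completing the square in [u] leaves the discriminant gap times [dotv v v]. The Young-type
    estimates below are instances of this, each reduced to a scalar check. *)
Lemma quadratic_form_ge0 (p k r : R) u v : 0 < p -> k ^+ 2 <= 4 * p * r ->
  0 <= p * dotv u u + k * dotv u v + r * dotv v v.
Proof.
move=> p0 disc; have := dotv_ge0 (u + (k / (2 * p)) *: v).
rewrite !dotvE (dotvC v u) => sq.
have -> : p * dotv u u + k * dotv u v + r * dotv v v =
    p * (dotv u u + k / (2 * p) * dotv u v +
         (k / (2 * p) * (dotv u v) + k / (2 * p) * (k / (2 * p) * dotv v v))) +
    (4 * p * r - k ^+ 2) / (4 * p) * dotv v v by field; lra.
rewrite addr_ge0 ?mulr_ge0 ?dotv_ge0 ?(ltW p0)//; first lra.
by rewrite invr_ge0; lra.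
Qed.

(** With [m] the velocity at the predictor, the last term becomes the negative defect that pays for
    the discretization errors. *)
Lemma sqr_norm_increment (p p' m : 'rV[R]_n) :
  dotv p' p' - dotv p p =
  2 * dotv (p' - p) m + dotv (p' - m) (p' - m) - dotv (p - m) (p - m).
Proof.
by rewrite !dotvE (dotvC m p) (dotvC m p'); ring.
Qed.

Lemma sqr_norm_sub_scale (h : R) (z m : 'rV[R]_n) :
  dotv (z - h *: m) (z - h *: m) =
  dotv z z - 2 * h * dotv m z + h ^+ 2 * dotv m m.
Proof. by rewrite !dotvE (dotvC z m); ring. Qed.

End DotProduct.

(** The bounds on [gam] are the interval for [alpha] rewritten through
    [alpha * (1 + h * gam) = 1]. *)
Record admissible (R : realType) (mux muy L s h gam : R) : Prop := Admissible {
  s_gt0 : 0 < s;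
  s_sqr : s ^+ 2 = mux * muy;
  s_le_mux : s <= mux;
  mux_le_L : mux <= L;
  h_gt0 : 0 < h;
  hL_le : h * L <= 2 / 15;
  gam_ge : s / 8 <= gam;
  gam_le : gam <= s / 4
}.

(** * Strong monotonicity and vanishing gradient at the saddle point *)

Section SaddleFacts.
Variables (R : realType) (n p : nat) (f : 'rV[R]_n -> 'rV[R]_p -> R).
Variables (L mux muy : R) (xs : 'rV[R]_n) (ys : 'rV[R]_p).
Hypotheses (lipf : lipschitz_gradient f L) (cvxf : strongly_convex_x f mux)
  (ccvf : strongly_concave_y f muy) (sadf : saddle_point f xs ys)
  (mux0 : 0 < mux) (muy0 : 0 < muy) (L0 : 0 < L).

Lemma lipschitz_gradient_sqr x x' y y' :
  dotv (gradx f x' y' - gradx f x y) (gradx f x' y' - gradx f x y) +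
  dotv (grady f x' y' - grady f x y) (grady f x' y' - grady f x y) <=
  L ^+ 2 * (dotv (x' - x) (x' - x) + dotv (y' - y) (y' - y)).
Proof.
have := lipf x x' y y'; rewrite /enorm2 !enorm_sqr => le.
have add_ge0 (m k : nat) (a : 'rV[R]_m) (b : 'rV[R]_k) : 0 <= dotv a a + dotv b b.
  by rewrite addr_ge0 ?dotv_ge0.
rewrite -[leLHS]sqr_sqrtr// -[in leRHS](sqr_sqrtr (add_ge0 _ _ _ _)) -exprMn.
by rewrite ler_sqr ?nnegrE ?mulr_ge0 ?sqrtr_ge0// ltW.
Qed.

(** Two convexity and two concavity inequalities are added, based at [(x, y)] and [(x', y')]; the
    values of [f] at the four corners cancel. *)
Lemma gradient_strongly_monotone x x' y y' :
  mux * dotv (x' - x) (x' - x) + muy * dotv (y' - y) (y' - y) <=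
  dotv (gradx f x' y' - gradx f x y) (x' - x) -
  dotv (grady f x' y' - grady f x y) (y' - y).
Proof.
have := cvxf x x' y; have := cvxf x' x y'.
have := ccvf x y y'; have := ccvf x' y' y.
rewrite -(opprB x' x) -(opprB y' y) !enorm_sqr !dotvNr !dotvNl !opprK.
rewrite !dotvDl !dotvNl; lra.
Qed.

(* Moving from [xs] by [t] against [g = gradx f xs ys] does not decrease [f], so
   convexity gives [<gradx f x' ys, g> <= 0], while for [t = 1 / (2 L)] the
   gradient has moved by at most [|g| / 2]. *)
Lemma gradx_saddle : gradx f xs ys = 0.
Proof.
set g := gradx f xs ys; apply: dotv_eq0.
pose t := (2 * L)^-1; pose x' := xs - t *: g.
have t0 : 0 < t by rewrite invr_gt0 mulr_gt0.
have step : x' - xs = - t *: g by rewrite /x' addrC addKr scaleNr.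
have /andP[_ min] := sadf x' ys.
have := cvxf x' xs ys; rewrite -(opprB x' xs) step enorm_sqr !dotvE => cvx.
have := lipschitz_gradient_sqr xs x' ys ys; rewrite subrr step !dotvE.
rewrite -/g (dotvC g (gradx f x' ys)).
rewrite dotv0l addr0; have -> : L ^+ 2 * (- t * (- t * dotv g g)) = dotv g g / 4.
  by rewrite /t; field; rewrite gt_eqF.
have := dotv_ge0 (gradx f x' ys); have := dotv_ge0 g.
have := dotv_ge0 (grady f x' ys - grady f xs ys); rewrite !dotvE.
have : dotv (gradx f x' ys) g <= 0.
  rewrite -(@pmulr_rle0 _ t)//.
  have : 0 <= mux * (t ^+ 2 * dotv g g) by rewrite !mulr_ge0 ?sqr_ge0 ?dotv_ge0 ?ltW.
  by move: cvx min; rewrite expr2; lra.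
lra.
Qed.

(** Mirror image of [gradx_saddle], with an ascent step in [y]. *)
Lemma grady_saddle : grady f xs ys = 0.
Proof.
set g := grady f xs ys; apply: dotv_eq0.
pose t := (2 * L)^-1; pose y' := ys + t *: g.
have t0 : 0 < t by rewrite invr_gt0 mulr_gt0.
have step : y' - ys = t *: g by rewrite /y' addrC addKr.
have /andP[max _] := sadf xs y'.
have := ccvf xs y' ys; rewrite -(opprB y' ys) step enorm_sqr !dotvE => ccv.
have := lipschitz_gradient_sqr xs xs ys y'; rewrite subrr step !dotvE.
rewrite -/g (dotvC g (grady f xs y')).
rewrite dotv0l add0r; have -> : L ^+ 2 * (t * (t * dotv g g)) = dotv g g / 4.
  by rewrite /t; field; rewrite gt_eqF.
have := dotv_ge0 (grady f xs y'); have := dotv_ge0 g.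
have := dotv_ge0 (gradx f xs y' - gradx f xs ys); rewrite !dotvE.
have : dotv (grady f xs y') g <= 0.
  rewrite -(@pmulr_rle0 _ t)//.
  have : 0 <= muy * (t ^+ 2 * dotv g g) by rewrite !mulr_ge0 ?sqr_ge0 ?dotv_ge0 ?ltW.
  by move: ccv max; rewrite expr2; lra.
lra.
Qed.

End SaddleFacts.

(** * Coefficients of the energy and their ranges *)

Section Energy.
Variables (R : realType) (n p : nat) (f : 'rV[R]_n -> 'rV[R]_p -> R).
Variables (L mux muy s h gam : R) (xs : 'rV[R]_n) (ys : 'rV[R]_p).
Hypotheses (lipf : lipschitz_gradient f L) (cvxf : strongly_convex_x f mux)
  (ccvf : strongly_concave_y f muy) (sadf : saddle_point f xs ys)
  (muy0 : 0 < muy) (adm : admissible mux muy L s h gam).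

Definition betacoef := mux * (1 + h * gam) / 8.
(** Total damping rate of the momentum: with [W = grady f x' y' + v'], the update reads
    [v' - v = h (betacoef W - deltacoef v')]. *)
Definition deltacoef := gam + betacoef.
(** The cross term takes two thirds of [gam]; nearly a third is left to damp [W] in
    [y_dissipation]. *)
Definition ecoef := 2 / 3 * gam.
Definition dcoef := ecoef * deltacoef.
Definition qcoef := deltacoef - ecoef * (1 + h * deltacoef).

Lemma hgam_bounds : 0 <= h * gam <= 1 / 30.
Proof.
have [s0 ss s_mux mux_L h0 hL gam_lb gam_ub] := adm.
(* [gam <= s / 4 <= L / 4], and a quarter of [2 / 15] is [1 / 30]. *)
have ? : h * gam <= h * (L / 4) by rewrite ler_wpM2l//; lra.
have ? : 0 <= h * gam by rewrite mulr_ge0//; lra.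
by apply/andP; split; lra.
Qed.

Lemma betacoef_bounds : mux / 8 <= betacoef <= 31 / 240 * mux.
Proof.
have [s0 ss s_mux mux_L h0 hL gam_lb gam_ub] := adm.
have /andP[? ?] := hgam_bounds; rewrite /betacoef; apply/andP; split; nra.
Qed.

Lemma deltacoef_bounds : mux / 8 <= deltacoef <= 2 / 5 * mux.
Proof.
have [s0 ss s_mux mux_L h0 hL gam_lb gam_ub] := adm.
have /andP[? ?] := betacoef_bounds; rewrite /deltacoef; apply/andP; split; lra.
Qed.

Lemma qcoef_bounds : mux / 8 <= qcoef <= mux / 4.
Proof.
have [s0 ss s_mux mux_L h0 hL gam_lb gam_ub] := adm.
have /andP[g0 g1] := hgam_bounds; have /andP[b0 b1] := betacoef_bounds.
have -> : qcoef = gam / 3 + betacoef - 2 / 3 * (h * gam) * gam - 2 / 3 * (h * gam) * betacoef.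
  by rewrite /qcoef /ecoef /deltacoef; field.
have -> : betacoef = mux / 8 + mux * (h * gam) / 8 by rewrite /betacoef; field.
set b := h * gam in g0 g1 *.
have ? : 0 <= b * gam by rewrite mulr_ge0 //; lra.
have ? : b * gam <= 1 / 30 * gam by rewrite ler_wpM2r //; lra.
have ? : 0 <= b * mux by rewrite mulr_ge0 //; lra.
have ? : b * mux <= 1 / 30 * mux by rewrite ler_wpM2r //; lra.
have ? : 0 <= b * (b * mux) by rewrite mulr_ge0 //; lra.
have ? : b * (b * mux) <= 1 / 30 * (b * mux) by rewrite ler_wpM2r //; lra.
by apply/andP; split; nra.
Qed.

(** The sum equals [deltacoef - h * ecoef * deltacoef]. It is the weight of the gradient pairings
    once the gap and [v] are eliminated from the energy. *)
Lemma qecoef_bounds : mux / 8 <= qcoef + ecoef <= deltacoef.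
Proof.
have [s0 ss s_mux mux_L h0 hL gam_lb gam_ub] := adm.
have /andP[q0 q1] := qcoef_bounds; have /andP[b0 b1] := deltacoef_bounds.
apply/andP; split; first by rewrite /ecoef; lra.
have ? : 0 <= gam * (h * deltacoef) by rewrite !mulr_ge0//; lra.
by rewrite /qcoef /ecoef; lra.
Qed.

Lemma ecoef_bounds : s / 12 <= ecoef <= s / 6.
Proof.
have [_ _ _ _ _ _ gam_lb gam_ub] := adm.
by rewrite /ecoef; apply/andP; split; lra.
Qed.

Lemma dcoef_bound : s / 12 * deltacoef <= dcoef.
Proof.
have /andP[? _] := ecoef_bounds; have /andP[? _] := deltacoef_bounds.
have [? _ ? _ _ _ _ _] := adm.
by rewrite /dcoef ler_wpM2r//; lra.
Qed.

Lemma coefs_ge0 : [/\ 0 <= gam, 0 <= ecoef, 0 <= dcoef & 0 <= qcoef].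
Proof.
have [? _ ? _ _ _ ? _] := adm; have /andP[? _] := ecoef_bounds.
have /andP[? _] := deltacoef_bounds; have /andP[? _] := qcoef_bounds.
split; [lra | lra | | lra].
by apply: mulr_ge0; lra.
Qed.

(** This is the multiplier of strong monotonicity against the saddle point in [energy_decrease]; the
    [s / 12] of [dcoef_bound] beats [s / 16]. *)
Lemma saddle_gap_coef_ge0 : 0 <= dcoef - s / 16 * (qcoef + ecoef).
Proof.
have [? _ ? _ _ _ _ _] := adm.
have := dcoef_bound; have /andP[? Z1] := qecoef_bounds.
have : s * (qcoef + ecoef) <= s * deltacoef by rewrite ler_wpM2l// ltW.
have : 0 <= s * (qcoef + ecoef) by rewrite mulr_ge0; lra.
lra.
Qed.

(** * Corrector error and dissipation inequalities *)

Lemma corrector_contraction (A B G Q : R) : 0 <= A -> 0 <= G -> 0 <= Q ->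
  A + G <= (h * L) ^+ 2 * Q -> B = (1 + h * mux / 8) ^+ 2 * G ->
  54 * (A + B) <= Q.
Proof.
have [? _ ? mux_L h0 hL _ _] := adm => A0 G0 Q0 AG ->.
have hmux : 0 <= h * mux <= h * L.
  by rewrite mulr_ge0 ?ler_wpM2l// ?(ltW h0)//; lra.
(* [61 / 60 = 1 + (2 / 15) / 8], and [54] works because [(61 / 60 * 2 / 15) ^+ 2 < 1 / 54]. *)
have hL2 : (h * L) ^+ 2 <= (2 / 15) ^+ 2 by rewrite ler_sqr ?nnegrE; lra.
have k2 : (1 + h * mux / 8) ^+ 2 <= (61 / 60) ^+ 2 by rewrite ler_sqr ?nnegrE; lra.
have := ler_wpM2r Q0 hL2; have := ler_wpM2r G0 k2.
lra.
Qed.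

(** The right side is the defect provided by the corrector; the left side collects the error terms,
    with weight 100, of [x_dissipation] and [y_dissipation]. *)
Lemma corrector_slack (A C Q : R) : 0 <= A -> 0 <= C -> C <= Q -> 54 * A <= Q ->
  h * (L * (C + 100 * A)) <= (Q - A) / 2.
Proof.
have [? _ ? mux_L h0 hL _ _] := adm => A0 C0 CQ AQ; rewrite mulrA.
have : h * L * (C + 100 * A) <= 2 / 15 * (C + 100 * A) by rewrite ler_wpM2r//; lra.
lra.
Qed.

(* [U], [U + a] and [U + a + c] stand for [- gradx f] at the new point, at the
   predictor and at the old point; likewise [W] and [W + b] below. *)
Lemma x_dissipation (U a c X : 'rV[R]_n) :
  0 <= mux * dotv (U + a) (U + a) - qcoef * dotv (U + a + c) (U + a)
     + L * (dotv c c + 100 * dotv a a) - dcoef * dotv a X - s / 32 * dotv U U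
     - s / 16 * (qcoef + ecoef) * dotv U X
     + ((dcoef - s / 16 * (qcoef + ecoef)) * mux - s / 32 * dcoef) * dotv X X.
Proof.
have [s0 ss s_mux mux_L h0 hL gam_lb gam_ub] := adm.
have /andP[q0 q1] := qcoef_bounds; have /andP[Z0 Z1] := qecoef_bounds.
have /andP[d0 d1] := deltacoef_bounds.
set Z := qcoef + ecoef in Z0 Z1 *.
have /andP[e0 e1] := ecoef_bounds.
have [gam0 ec0 _ qc0] := coefs_ge0.
have sge0 := ltW s0; have mux0 : 0 <= mux by exact: le_trans s_mux.
have del0 : 0 <= deltacoef by lra.
have Zge0 : 0 <= Z by lra.
have muxL0 : 0 <= L by exact: le_trans mux_L.
have X0 := dotv_ge0 X; have a0 := dotv_ge0 a; have U0 := dotv_ge0 U.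
have c0 := dotv_ge0 c; have T0 := dotv_ge0 (U + a).
(* With [mux / 64] the discriminant condition is exactly [qcoef <= mux / 4]. *)
have quc : 0 <= mux * dotv c c + (- qcoef) * dotv c (U + a) + mux / 64 * dotv (U + a) (U + a).
  by apply: quadratic_form_ge0; nra.
(* The form is the square of [U + 2 a]; it converts dissipation at the predictor into dissipation of
   [U]. *)
have split_ua : 0 <= 2 * dotv (U + a) (U + a) - dotv U U + 2 * dotv a a.
  have := dotv_ge0 (U + 2 *: a); rewrite !dotvE (dotvC a U); lra.
have sd0 : 0 < s * deltacoef by rewrite mulr_gt0//; lra.
have sd2 : (s * deltacoef) ^+ 2 <= s * deltacoef * (mux * mux).
  rewrite expr2 ler_wpM2l ?mulr_ge0//.
  by rewrite ler_pM//; lra.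
have sd20 := sqr_ge0 (s * deltacoef).
have qux : 0 <= mux / 4 * dotv U U + (- (s / 16 * Z)) * dotv U X
                + s * deltacoef * mux / 128 * dotv X X.
  apply: quadratic_form_ge0; first lra.
  rewrite sqrrN.
  have -> : 4 * (mux / 4) * (s * deltacoef * mux / 128) = s * deltacoef * (mux * mux) / 128 by field.
  have ? : s * Z <= s * deltacoef by rewrite ler_wpM2l.
  have ? : 0 <= s * Z by rewrite mulr_ge0.
  have ? : (s / 16 * Z) ^+ 2 <= (s * deltacoef / 16) ^+ 2.
    by rewrite ler_sqr ?nnegrE; lra.
  lra.
have qax : 0 <= (50 * L) * dotv a a + (- dcoef) * dotv a X
                + s * deltacoef * mux / 128 * dotv X X.
  apply: quadratic_form_ge0; first lra.
  rewrite sqrrN /dcoef.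
  have ? : ecoef * deltacoef <= s / 6 * deltacoef by rewrite ler_wpM2r.
  have ? : 0 <= ecoef * deltacoef by rewrite mulr_ge0.
  have ? : (ecoef * deltacoef) ^+ 2 <= (s * deltacoef / 6) ^+ 2.
    by rewrite ler_sqr ?nnegrE; lra.
  have : s * deltacoef * (mux * mux) <= s * deltacoef * (L * mux).
    by rewrite ler_wpM2l ?mulr_ge0 ?ler_wpM2r.
  lra.
(* [1 / 64 = 1 / 12 - 1 / 16 - 1 / 192]; [qux] and [qax] each use half of it. *)
have coefX : s * deltacoef * mux / 64 <= (dcoef - s / 16 * Z) * mux - s / 32 * dcoef.
  rewrite /dcoef.
  have ? : s / 12 * deltacoef * mux <= ecoef * deltacoef * mux.
    by rewrite ler_wpM2r ?dcoef_bound.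
  have ? : s / 16 * Z * mux <= s / 16 * deltacoef * mux by rewrite ler_wpM2r ?ler_wpM2l ?divr_ge0.
  have ? : ecoef * deltacoef <= mux / 6 * deltacoef by rewrite ler_wpM2r//; lra.
  have ? : s * (ecoef * deltacoef) <= s * (mux / 6 * deltacoef) by rewrite ler_wpM2l.
  lra.
have : s * deltacoef * mux / 64 * dotv X X <=
       ((dcoef - s / 16 * Z) * mux - s / 32 * dcoef) * dotv X X.
  by rewrite ler_wpM2r.
have : qcoef * dotv (U + a) (U + a) <= mux / 4 * dotv (U + a) (U + a).
  by rewrite ler_wpM2r.
have : mux * dotv c c <= L * dotv c c by rewrite ler_wpM2r.
have : mux * dotv a a <= L * dotv a a by rewrite ler_wpM2r.
have : s * dotv U U <= mux * dotv U U by rewrite ler_wpM2r.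
have : 0 <= mux * (2 * dotv (U + a) (U + a) - dotv U U + 2 * dotv a a).
  by rewrite mulr_ge0//; lra.
have : 0 <= mux * dotv (U + a) (U + a) by rewrite mulr_ge0.
have : 0 <= mux * dotv U U by rewrite mulr_ge0.
have : 0 <= mux * dotv a a by rewrite mulr_ge0.
rewrite (dotvDl (U + a) c (U + a)).
lra.
Qed.

Lemma y_dissipation (W b Y : 'rV[R]_p) :
  0 <= (gam - ecoef * (1 + h * gam)) * dotv W (W + b) - s / 32 * dotv W W
     - s / 16 * ecoef * dotv W Y
     + s / 16 * (qcoef * muy / 2 - ecoef * gam / 2) * dotv Y Y
     - ecoef * gam * dotv b Y + 100 * L * dotv b b.
Proof.
have [s0 ss s_mux mux_L h0 hL gam_lb gam_ub] := adm.
have /andP[q0 q1] := qcoef_bounds; have /andP[g0 g1] := hgam_bounds.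
have W0 := dotv_ge0 W; have b0 := dotv_ge0 b; have Y0 := dotv_ge0 Y.
have gam0 : 0 < gam by lra.
have L0 : 0 <= L by lra.
have gamge0 := ltW gam0; have sge0 := ltW s0.
set eta := gam - ecoef * (1 + h * gam).
have eta0 : 28 / 90 * gam <= eta.
  have ? : gam * (h * gam) <= gam * (1 / 30) by rewrite ler_wpM2l//; lra.
  by rewrite /eta /ecoef; lra.
have eta1 : eta <= gam / 3.
  have ? : 0 <= gam * (h * gam) by rewrite mulr_ge0//; lra.
  by rewrite /eta /ecoef; lra.
have qy : s ^+ 2 / 8 <= qcoef * muy.
  have ? : mux / 8 * muy <= qcoef * muy by rewrite ler_wpM2r// ltW.
  by rewrite ss; lra.
have eg : ecoef * gam <= s ^+ 2 / 24.
  have ? : gam ^+ 2 <= (s / 4) ^+ 2 by rewrite ler_sqr ?nnegrE; lra.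
  by rewrite /ecoef; lra.
have eg0 : 0 <= ecoef * gam by rewrite mulr_ge0 /ecoef; lra.
have s30 : 0 < s ^+ 3 by rewrite exprn_gt0.
(* By [qy] and [eg], the bracket is at least [s ^+ 2 / 16 - s ^+ 2 / 48 = s ^+ 2 / 24]. *)
have coefY : s ^+ 3 / 384 <= s / 16 * (qcoef * muy / 2 - ecoef * gam / 2).
  have -> : s ^+ 3 / 384 = s / 16 * (s ^+ 2 / 24) by field.
  by rewrite ler_wpM2l//; lra.
(* After paying [s / 32 <= gam / 4], [eta] leaves at least [gam / 17] on [W]. The budgets for [W]
   and [Y] are split 85 to 15, and [100 * L] for [b] in halves, among the three pairings. *)
have quWY : 0 <= 85 / 100 * (gam / 17) * dotv W W + (- (s / 16 * ecoef)) * dotv W Y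
    + 85 / 100 * (s ^+ 3 / 384) * dotv Y Y.
  apply: quadratic_form_ge0; first lra.
  rewrite sqrrN /ecoef.
  have -> : (s / 16 * (2 / 3 * gam)) ^+ 2 = s ^+ 2 * gam * gam / 576 by field.
  have -> : 4 * (85 / 100 * (gam / 17)) * (85 / 100 * (s ^+ 3 / 384)) =
    s ^+ 2 * gam * s * (4 * (85 / 100) ^+ 2 / 17 / 384) by field.
  have : s ^+ 2 * gam * gam <= s ^+ 2 * gam * (s / 4).
    by rewrite ler_wpM2l// mulr_ge0 ?exprn_ge0.
  have : 0 <= s ^+ 2 * gam * s by rewrite !mulr_ge0 ?exprn_ge0.
  lra.
have quWb : 0 <= 15 / 100 * (gam / 17) * dotv W W + eta * dotv W b + 50 * L * dotv b b.
  apply: quadratic_form_ge0; first lra.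
  have : eta ^+ 2 <= (gam / 3) ^+ 2 by rewrite ler_sqr ?nnegrE; lra.
  have : gam * gam <= gam * L by rewrite ler_wpM2l//; lra.
  have : 0 <= gam * gam by rewrite -expr2 sqr_ge0.
  lra.
have quYb : 0 <= 50 * L * dotv b b + (- (ecoef * gam)) * dotv b Y
    + 15 / 100 * (s ^+ 3 / 384) * dotv Y Y.
  apply: quadratic_form_ge0; first lra.
  have : (ecoef * gam) ^+ 2 <= (s ^+ 2 / 24) ^+ 2 by rewrite ler_sqr ?nnegrE; lra.
  have : s ^+ 3 * s <= s ^+ 3 * L by rewrite ler_wpM2l//; lra.
  have : 0 <= s ^+ 3 * s by rewrite mulr_ge0 ?ltW.
  rewrite sqrrN; have -> : (s ^+ 2 / 24) ^+ 2 = s ^+ 3 * s / 576 by field.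
  lra.
have : s ^+ 3 / 384 * dotv Y Y <=
   s / 16 * (qcoef * muy / 2 - ecoef * gam / 2) * dotv Y Y by rewrite ler_wpM2r.
have : (gam / 17 + s / 32) * dotv W W <= eta * dotv W W by rewrite ler_wpM2r//; lra.
rewrite dotvDr; lra.
Qed.

(** * Exact one-step identities *)

Lemma x_balance (k : R) (u ut U X : 'rV[R]_n) :
  (dotv U U - dotv u u) / 2
    + k / 2 * (dotv X X - dotv (X - h *: ut) (X - h *: ut)) =
  dotv (U - u) ut + (dotv (U - ut) (U - ut) - dotv (u - ut) (u - ut)) / 2
    + k * h * dotv ut X - k * h ^+ 2 / 2 * dotv ut ut.
Proof. by rewrite (sqr_norm_increment u U ut) sqr_norm_sub_scale; field. Qed.

(* The weights [dcoef] and [qcoef] are tuned so that [v'] is paired with neither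
   [Y] nor [wt] on the right-hand side. *)
Lemma y_balance (w wt W v v' Y : 'rV[R]_p) :
  v = (1 + h * gam) *: v' - (h * betacoef) *: (W - v') ->
  (dotv W W - dotv w w) / 2
    + ecoef * gam / 2 * (dotv Y Y - dotv (Y - h *: wt) (Y - h *: wt))
    + ecoef * (dotv v' Y - dotv v (Y - h *: wt)) - qcoef * h * dotv (W - v') wt =
  dotv ((W - v') - (w - v)) wt
    + (dotv (W - wt) (W - wt) - dotv (w - wt) (w - wt)) / 2
    - h * (gam - ecoef * (1 + h * gam)) * dotv W wt
    + ecoef * gam * h * dotv (wt - W) Y + dcoef * h * dotv (W - v') Y
    - ecoef * gam * h ^+ 2 / 2 * dotv wt wt.
Proof.
move=> ->; rewrite (sqr_norm_increment w W wt) sqr_norm_sub_scale !dotvE.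
by rewrite /qcoef /dcoef /ecoef /deltacoef /betacoef; field.
Qed.

(** * One-step decrease of the energy *)

Definition energy (x : 'rV[R]_n) (y v : 'rV[R]_p) : R :=
  (dotv (gradx f x y) (gradx f x y) + dotv (grady f x y + v) (grady f x y + v)) / 2
  - qcoef * (f x y - f xs ys) + dcoef / 2 * dotv (x - xs) (x - xs)
  + ecoef * gam / 2 * dotv (y - ys) (y - ys) + ecoef * dotv v (y - ys).

Lemma gap_lower_bound x y :
  dotv (grady f x y) (y - ys) + muy / 2 * dotv (y - ys) (y - ys) <= f x y - f xs ys.
Proof.
have := ccvf x y ys; have /andP[_ ?] := sadf x ys.
rewrite -(opprB y ys) enorm_sqr !dotvNr !dotvNl; lra.
Qed.

(** The two balances give the energy change exactly, apart from the increment of [f]; the remaining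
    facts are inequalities with their multipliers, and the claim is a linear combination of them. *)
Lemma energy_decrease (x x' xt : 'rV[R]_n) (y y' yt v v' vt : 'rV[R]_p) (alpha rho : R) :
  alpha * (1 + h * gam) = 1 -> rho = h * mux / 8 ->
  xt = x - h *: gradx f x y -> yt = y + h *: (grady f x y + v) ->
  vt = alpha *: v + rho *: grady f xt yt ->
  x' = x - h *: gradx f xt yt -> y' = y + h *: (grady f xt yt + vt) ->
  v' = alpha *: v + rho *: grady f x' y' ->
  (1 + h * s / 16) * energy x' y' v' <= energy x y v.
Proof.
move=> alphaE rhoE xtE ytE vtE x'E y'E v'E.
have [s0 ss s_mux mux_L h0 hL gam_lb gam_ub] := adm.
have mux0 : 0 < mux by lra.
have L0 : 0 < L by lra.
rewrite /energy.
set g := grady f x y; set gt := grady f xt yt; set g' := grady f x' y'.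
pose u := - gradx f x y; pose ut := - gradx f xt yt; pose U := - gradx f x' y'.
pose w := g + v; pose wt := gt + vt; pose W := g' + v'.
pose X := x' - xs; pose Y := y' - ys.
have [uE utE UE] : [/\ u = - gradx f x y, ut = - gradx f xt yt & U = - gradx f x' y'] by [].
have [wE wtE WE] : [/\ w = g + v, wt = gt + vt & W = g' + v'] by [].
have [XE YE] : X = x' - xs /\ Y = y' - ys by [].
clearbody u ut U w wt W X Y.
have dx : x' - x = h *: ut by rewrite utE x'E addrC addKr scalerN.
have dy : y' - y = h *: wt by rewrite wtE y'E addrC addKr.
have xE : x - xs = X - h *: ut by rewrite XE -dx opprB [RHS]addrC addrA subrK.
have yE : y - ys = Y - h *: wt by rewrite YE -dy opprB [RHS]addrC addrA subrK.
have dxt : x' - xt = h *: (ut - u).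
  rewrite scalerBr -dx {1}xtE opprB addrA [RHS]addrAC.
  by rewrite [in RHS]uE scalerN opprK addrAC.
have dyt : y' - yt = h *: (wt - w).
  by rewrite scalerBr -dy {1}ytE -/g -wE opprD addrA.
(* The momentum update is inverted: [1 / alpha = 1 + h * gam] and
   [(1 + h * gam) * rho = h * betacoef]. *)
have vE : v = (1 + h * gam) *: v' - (h * betacoef) *: (W - v').
  rewrite WE addrK {1}v'E scalerDr !scalerA (mulrC _ alpha) alphaE scale1r -/g'.
  by rewrite rhoE /betacoef -addrA -scalerBl (_ : _ - _ = 0) ?scale0r ?addr0//; field.
(* [v'] and [vt] share [alpha *: v], so only the gradient difference survives. *)
have WwtE : W - wt = (1 + rho) *: (g' - gt).
  rewrite WE wtE v'E vtE -/g' -/gt opprD addrACA scalerDl scale1r; congr (_ + _).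
  by rewrite opprD addrACA subrr add0r scalerBr.
have gE : g = w - v by rewrite wE addrK.
have g'E : g' = W - v' by rewrite WE addrK.
have UU : dotv (gradx f x' y') (gradx f x' y') = dotv U U by rewrite UE dotvNl dotvNr opprK.
have uu : dotv (gradx f x y) (gradx f x y) = dotv u u by rewrite uE dotvNl dotvNr opprK.
rewrite UU uu -wE -WE -XE -YE xE yE.
have mono : dotv (U - u) ut + dotv (g' - g) wt <= - h * mux * dotv ut ut.
  have := gradient_strongly_monotone cvxf ccvf x x' y y'.
  rewrite dx dy -/g -/g' (_ : gradx f x' y' - gradx f x y = u - U); last first.
    by rewrite uE UE opprK addrC.
  rewrite -(opprB U u) !dotvNl !dotvZl !dotvZr => mon; rewrite -(ler_pM2l h0).
  have : 0 <= muy * (h ^+ 2 * dotv wt wt) by rewrite !mulr_ge0 ?sqr_ge0 ?dotv_ge0 ?ltW.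
  lra.
(* Passing through [f x' y]: convexity in [x] from the old point, concavity in [y] from the new
   one. *)
have fdiff : h * dotv g' wt - h * dotv u ut <= f x' y' - f x y.
  have := cvxf x x' y; have := ccvf x' y' y.
  rewrite -(opprB y' y) dx dy !enorm_sqr !dotvNl !dotvNr !dotvZl !dotvZr -/g'.
  rewrite (_ : gradx f x y = - u) ?dotvNl; last by rewrite uE opprK.
  have : 0 <= mux * (h * (h * dotv ut ut)) by rewrite !mulr_ge0 ?dotv_ge0 ?ltW.
  have : 0 <= muy * (h * (h * dotv wt wt)) by rewrite !mulr_ge0 ?dotv_ge0 ?ltW.
  lra.
have PhiX : dotv U X + dotv g' Y <= - mux * dotv X X.
  have := gradient_strongly_monotone cvxf ccvf xs x' ys y'.
  rewrite (gradx_saddle lipf cvxf sadf mux0 L0) (grady_saddle lipf ccvf sadf muy0 L0).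
  rewrite !subr0 -XE -YE -/g' (_ : gradx f x' y' = - U) ?dotvNl; last by rewrite UE opprK.
  have : 0 <= muy * dotv Y Y by rewrite mulr_ge0 ?dotv_ge0 ?ltW.
  lra.
have gap := gap_lower_bound x' y'; rewrite -/g' -YE in gap.
pose c := u - ut; pose a := ut - U; pose b := wt - W.
have [cE aE bE] : [/\ c = u - ut, a = ut - U & b = wt - W] by [].
clearbody a b c.
(* The new point differs from the predictor by [h] times the velocity error, so the Lipschitz bound
   gains a factor [h * L]. *)
have lip : 54 * (dotv a a + dotv b b) <= dotv c c + dotv (w - wt) (w - wt).
  have := lipschitz_gradient_sqr lipf L0 xt x' yt y'.
  rewrite dxt dyt -/g' -/gt (_ : gradx f x' y' - gradx f xt yt = a); last first.
    by rewrite aE utE UE opprK addrC.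
  rewrite -(opprB u ut) -(opprB w wt) -cE bE -(opprB W wt) WwtE.
  rewrite !dotvNl !dotvNr !opprK !dotvZl !dotvZr !dotvNl !dotvNr !opprK.
  move=> lipz; apply: (corrector_contraction (dotv_ge0 _) (dotv_ge0 (g' - gt))).
  - by rewrite addr_ge0 ?dotv_ge0.
  - by rewrite (le_trans lipz)// le_eqVlt; apply/orP; left; apply/eqP; ring.
  - by rewrite rhoE; ring.
have xbal := x_balance dcoef u ut U X.
have ybal := y_balance w wt Y vE.
have := x_dissipation U a c X; have := y_dissipation W b Y.
have -> : W + b = wt by rewrite bE addrC subrK.
have -> : U + a = ut by rewrite aE addrC subrK.
have -> : ut + c = u by rewrite cE addrC subrK.
set gap' := f x' y' - f xs ys in gap *.
have [gam0 e0 d0 q0] := coefs_ge0.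
have dZ := saddle_gap_coef_ge0.
have F1 : 0 <= qcoef * (f x' y' - f x y - h * dotv g' wt + h * dotv u ut).
  by apply: mulr_ge0 q0 _; lra.
rewrite -(pmulr_rge0 _ h0) => F2y; rewrite -(pmulr_rge0 _ h0) => F2x.
(* The part [s / 16 * (qcoef + ecoef)] of [dcoef] is held back: it cancels the [dotv g' Y] that
   arises from [h * s / 16] times the new energy, after [F4] bounds the gap. *)
have F3 : 0 <= h * ((dcoef - s / 16 * (qcoef + ecoef)) *
    (- mux * dotv X X - dotv U X - dotv g' Y)).
  by apply: mulr_ge0 (ltW h0) (mulr_ge0 dZ _); lra.
have F4 : 0 <= h * (s * (qcoef * (gap' - dotv g' Y - muy / 2 * dotv Y Y))).
  by apply: mulr_ge0 (ltW h0) (mulr_ge0 (ltW s0) (mulr_ge0 q0 _)); lra.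
have F5 : h * (L * (dotv c c + 100 * (dotv a a + dotv b b))) <=
    (dotv c c + dotv (w - wt) (w - wt) - (dotv a a + dotv b b)) / 2.
  by apply: corrector_slack => //; rewrite ?addr_ge0 ?lerDl ?dotv_ge0.
(* The second-order terms of the balances have a favourable sign; [F6] and [F7] discard them. *)
have F6 : 0 <= h ^+ 2 * (dcoef * dotv ut ut).
  exact: mulr_ge0 (sqr_ge0 _) (mulr_ge0 d0 (dotv_ge0 _)).
have F7 : 0 <= h ^+ 2 * (ecoef * gam * dotv wt wt).
  exact: mulr_ge0 (sqr_ge0 _) (mulr_ge0 (mulr_ge0 e0 gam0) (dotv_ge0 _)).
have aU : dotv (U - ut) (U - ut) = dotv a a by rewrite aE dotvB_swap.
have bW : dotv (W - wt) (W - wt) = dotv b b by rewrite bE dotvB_swap.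
have ax : dotv a X = dotv ut X - dotv U X by rewrite aE dotvDl dotvNl.
have bY : dotv b Y = dotv wt Y - dotv W Y by rewrite bE dotvDl dotvNl.
have vY : dotv v' Y = dotv W Y - dotv g' Y by rewrite WE dotvDl addrAC subrr add0r.
have gapE : f x y - f xs ys = gap' - (f x' y' - f x y) by rewrite /gap' opprB [RHS]addrC addrA subrK.
rewrite -gE -g'E in ybal.
rewrite gapE vY; rewrite vY bW -bE in ybal; rewrite aU -cE in xbal.
move: F1 F2x F2y F3 F4 F5 F6 F7 xbal ybal mono; rewrite ax bY.
clearbody g g' gt gap'; clear.
lra.
Qed.

(** * Comparison of the energy with the squared distance *)

Lemma ecoef_gam_le : ecoef * gam <= s ^+ 2 / 24.
Proof.
have [? _ ? _ _ _ ? ?] := adm.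
have : gam ^+ 2 <= (s / 4) ^+ 2 by rewrite ler_sqr ?nnegrE; lra.
by rewrite /ecoef; lra.
Qed.

Lemma energy_start x y : energy x y 0 <= L ^+ 2 * sqdist x xs y ys.
Proof.
have [s0 ss s_mux mux_L h0 hL gam_lb gam_ub] := adm.
have L0 : 0 < L by lra.
have mux0 : 0 < mux by lra.
have [gam0 e0 d0 q0] := coefs_ge0.
have [_ q1] := andP qcoef_bounds; have [_ d1] := andP deltacoef_bounds.
have [_ e1] := andP ecoef_bounds.
have := lipschitz_gradient_sqr lipf L0 xs x ys y.
rewrite (gradx_saddle lipf cvxf sadf mux0 L0) (grady_saddle lipf ccvf sadf muy0 L0).
have := gap_lower_bound x y.
rewrite /energy /sqdist !enorm_sqr !subr0 addr0 dotv0l mulr0 addr0.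
have sq (a b : 'rV[R]_p) : 0 <= dotv a a + 2 * L * dotv a b + L ^+ 2 * dotv b b.
  by have := dotv_ge0 (a + L *: b); rewrite !dotvE (dotvC b a); lra.
set X := x - xs; set Y := y - ys.
set gx := gradx f x y; set g := grady f x y; set gap := f x y - f xs ys.
have X0 := dotv_ge0 X; have Y0 := dotv_ge0 Y; have g0 := dotv_ge0 gx.
set D := dotv X X + dotv Y Y => gapb lip.
have D0 : 0 <= D by apply: addr_ge0.
have muyY : 0 <= muy * dotv Y Y by rewrite mulr_ge0 // ltW.
(* The gap is at least [dotv g Y], and [sq] bounds [- dotv g Y] by the squares of [g] and
   [L *: Y]. *)
have N : - gap <= L * D.
  rewrite -(ler_pM2l L0).
  have ? : L * (- gap) <= L * (- dotv g Y) by rewrite ler_wpM2l ?(ltW L0)//; lra.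
  have ? : 0 <= L ^+ 2 * dotv X X by rewrite mulr_ge0 ?sqr_ge0.
  move: (sq g Y) lip; rewrite /D; lra.
have qN : qcoef * - gap <= L ^+ 2 / 4 * D.
  have ? : qcoef * - gap <= qcoef * (L * D) by rewrite ler_wpM2l.
  have ? : qcoef * (L * D) <= L / 4 * (L * D).
    by rewrite ler_wpM2r ?mulr_ge0// ?(ltW L0)//; lra.
  lra.
have s2 : s ^+ 2 <= L ^+ 2 by rewrite ler_sqr ?nnegrE; lra.
have dX : dcoef * dotv X X <= L ^+ 2 / 15 * dotv X X.
  rewrite ler_wpM2r//; apply: (@le_trans _ _ (L / 6 * (2 / 5 * L))); last lra.
  by rewrite /dcoef; apply: ler_pM => //; have [? _] := andP deltacoef_bounds; lra.
have eY : ecoef * gam * dotv Y Y <= L ^+ 2 / 24 * dotv Y Y.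
  by rewrite ler_wpM2r//; have := ecoef_gam_le; lra.
have : 0 <= L ^+ 2 * dotv X X by rewrite mulr_ge0 ?sqr_ge0.
have : 0 <= L ^+ 2 * dotv Y Y by rewrite mulr_ge0 ?sqr_ge0.
by rewrite /D in qN lip *; lra.
Qed.

(** Substituting [v = W - g] and bounding the gap from above ([F1]) and [- dotv g Y] from below
    ([F2]) leaves one quadratic form in [(gx, X)] and one in [(W, Y)]. *)
Lemma energy_coercive x y v : s ^+ 2 / 32 * sqdist x xs y ys <= energy x y v.
Proof.
have [s0 ss s_mux mux_L h0 hL gam_lb gam_ub] := adm.
have L0 : 0 < L by lra.
have mux0 : 0 < mux by lra.
have [gam0 e0 d0 q0] := coefs_ge0.
have [qlb _] := andP qcoef_bounds; have [_ d1] := andP deltacoef_bounds.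
have [Z0 Z1] := andP qecoef_bounds.
have := gradient_strongly_monotone cvxf ccvf xs x ys y.
have := cvxf x xs y; have := ccvf xs ys y.
rewrite (gradx_saddle lipf cvxf sadf mux0 L0) (grady_saddle lipf ccvf sadf muy0 L0).
rewrite !subr0 /energy /sqdist -(opprB x xs) !enorm_sqr !dotvNl !dotvNr opprK dotv0l.
have -> : dotv v (y - ys) = dotv (grady f x y + v) (y - ys) - dotv (grady f x y) (y - ys).
  by rewrite dotvDl addrAC subrr add0r.
set W := grady f x y + v; set X := x - xs; set Y := y - ys.
set gx := gradx f x y; set g := grady f x y.
have X0 := dotv_ge0 X; have Y0 := dotv_ge0 Y.
have qx : 0 <= 1 / 2 * dotv gx gx + (- (qcoef + ecoef)) * dotv gx X
    + ((qcoef + ecoef) * mux / 2 - s ^+ 2 / 32) * dotv X X.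
  apply: quadratic_form_ge0; first lra.
  have ? : s ^+ 2 <= mux ^+ 2 by rewrite ler_sqr ?nnegrE; lra.
  (* The sum lies between [mux / 8] and [2 / 5 * mux]; the discriminant needs only [s ^+ 2 / 16],
     and [3 / 40 > 1 / 16]. *)
  have ? : mux / 8 * (3 / 5 * mux) <= (qcoef + ecoef) * (mux - (qcoef + ecoef)).
    by apply: ler_pM; lra.
  by rewrite sqrrN; have := sqr_ge0 mux; lra.
have qy : 0 <= 1 / 2 * dotv W W + ecoef * dotv W Y
    + (qcoef * muy / 2 + ecoef * gam / 2 - s ^+ 2 / 32) * dotv Y Y.
  apply: quadratic_form_ge0; first lra.
  have ? : mux / 8 * muy <= qcoef * muy by rewrite ler_wpM2r// ltW.
  have ? : ecoef * ecoef <= ecoef * gam by rewrite ler_wpM2l//; rewrite /ecoef; lra.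
  by have := sqr_ge0 s; lra.
move=> ccv cvx mon.
have F1 : 0 <= qcoef * (dotv gx X - mux / 2 * dotv X X - muy / 2 * dotv Y Y
    - (f x y - f xs ys)).
  by apply: mulr_ge0 => //; lra.
have F2 : 0 <= ecoef * (dotv gx X - dotv g Y - mux * dotv X X - muy * dotv Y Y).
  by apply: mulr_ge0 => //; lra.
have F3 : 0 <= ecoef * (mux * dotv X X).
  by apply: mulr_ge0 => //; apply: mulr_ge0 => //; exact: ltW.
have F4 : 0 <= ecoef * (muy * dotv Y Y).
  by apply: mulr_ge0 => //; apply: mulr_ge0 => //; exact: ltW.
have F5 : 0 <= dcoef * dotv X X by apply: mulr_ge0.
lra.
Qed.

Lemma energy_pce_dm alpha rho (x : nat -> 'rV[R]_n) (y v : nat -> 'rV[R]_p) :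
  alpha * (1 + h * gam) = 1 -> rho = h * mux / 8 -> pce_dm f h alpha rho x y v ->
  forall T, (1 + h * s / 16) ^+ T * energy (x T) (y T) (v T) <=
            energy (x 0) (y 0) (v 0).
Proof.
move=> alphaE rhoE [_ iter]; have [s0 _ _ _ h0 _ _ _] := adm.
elim=> [|T IH]; first by rewrite mul1r.
have [xS yS vS] := iter T; apply: le_trans IH; rewrite exprSr -mulrA ler_wpM2l//.
  by rewrite exprn_ge0// addr_ge0// !mulr_ge0// ?invr_ge0// ltW.
exact: (energy_decrease alphaE rhoE _ _ _ xS yS vS).
Qed.

End Energy.

(** * From energy decay to the rate and the iteration count *)

Lemma expR_le_1D2x (R : realType) (a : R) : 0 <= a <= 1 / 2 -> expR a <= 1 + 2 * a.
Proof.
move=> /andP[a0 a1]; have b0 : 0 < 1 + 2 * a by lra.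
rewrite -[expR a]invrK -expRN invf_ple ?posrE ?expR_gt0//.
apply: le_trans (expR_ge1Dx _); rewrite -div1r ler_pdivrMr//.
(* [(1 - a) (1 + 2 a) = 1 + 2 a (1 / 2 - a)], which is at least 1. *)
have : 0 <= a * (1 / 2 - a) by rewrite mulr_ge0//; lra.
lra.
Qed.

(** The reciprocals of the endpoints for [alpha] are [1 + h * s / 4] and [1 + h * s / 8]. *)
Lemma inverse_momentum_bounds (R : realType) (alpha h s : R) : 0 < h -> 0 < s ->
  4 / (4 + h * s) <= alpha -> alpha <= 8 / (8 + h * s) ->
  [/\ 0 < alpha, s / 8 <= (alpha^-1 - 1) / h & (alpha^-1 - 1) / h <= s / 4].
Proof.
move=> h0 s0 lb ub; have hs : 0 < h * s by rewrite mulr_gt0.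
have alpha0 : 0 < alpha by apply: lt_le_trans lb; rewrite divr_gt0//; lra.
have {}lb : 4 <= alpha * (4 + h * s) by move: lb; rewrite ler_pdivrMr//; lra.
have {}ub : alpha * (8 + h * s) <= 8 by move: ub; rewrite ler_pdivlMr//; lra.
split=> //; [rewrite ler_pdivlMr// | rewrite ler_pdivrMr//].
  by rewrite lerBrDr -[alpha^-1]div1r ler_pdivlMr//; lra.
by rewrite lerBlDr -[alpha^-1]div1r ler_pdivrMr//; lra.
Qed.

Theorem theorem3p7 (R : realType) (n p : nat)
    (f : 'rV[R]_n -> 'rV[R]_p -> R) (L mux muy : R)
    (xs : 'rV[R]_n) (ys : 'rV[R]_p) (h rho alpha : R)
    (x : nat -> 'rV[R]_n) (y v : nat -> 'rV[R]_p) :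
  continuously_differentiable f ->
  lipschitz_gradient f L ->
  strongly_convex_x f mux ->
  strongly_concave_y f muy ->
  mux <= L -> muy <= mux -> 0 < muy ->
  saddle_point f xs ys ->
  0 < h -> h <= 2 / (15 * L) ->
  rho = h * mux / 8 ->
  4 / (4 + h * Num.sqrt (mux * muy)) <= alpha ->
  alpha <= 8 / (8 + h * Num.sqrt (mux * muy)) ->
  pce_dm f h alpha rho x y v ->
  let D := fun t : nat => sqdist (x t) xs (y t) ys in
  (forall T : nat,
     D T <= 32 * L ^+ 2 / (muy * Num.sqrt (mux * muy)) *
            (1 + h * Num.sqrt (mux * muy) / 16) ^- T * D 0%N) /\
  (forall eps : R, 0 < eps -> eps < 1 ->
   forall T : nat,
     32 / (h * Num.sqrt (mux * muy)) *
       ln (32 * L ^+ 2 / (muy * Num.sqrt (mux * muy) * eps)) <= T%:R ->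
     D T <= eps * D 0%N).
Proof.
move=> _ lipf cvxf ccvf mux_L muy_mux muy0 sadf h0 hL rhoE alb aub iter D.
set s := Num.sqrt (mux * muy) in alb aub *.
have mux0 : 0 < mux by lra.
have L0 : 0 < L by lra.
have s0 : 0 < s by rewrite sqrtr_gt0 mulr_gt0.
have ss : s ^+ 2 = mux * muy by rewrite sqr_sqrtr// mulr_ge0// ltW.
have s_mux : s <= mux.
  by rewrite -(@ler_pXn2r _ 2)// ?nnegrE ?(ltW s0) ?(ltW mux0) ?(ltW muy0)// ss expr2 ler_wpM2l// ltW.
have muy_s : muy <= s.
  by rewrite -(@ler_pXn2r _ 2)// ?nnegrE ?(ltW s0) ?(ltW mux0) ?(ltW muy0)// ss expr2 ler_wpM2r// ltW.
have [alpha0 gam_lb gam_ub] := inverse_momentum_bounds h0 s0 alb aub.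
have hL' : h * L <= 2 / 15.
  by move: hL; rewrite ler_pdivlMr; lra.
have adm : admissible mux muy L s h ((alpha^-1 - 1) / h) by split.
have alphaE : alpha * (1 + h * ((alpha^-1 - 1) / h)) = 1 by field; lra.
have D0 t : 0 <= D t by rewrite addr_ge0// sqr_ge0.
set k := 1 + h * s / 16; set C := 32 * L ^+ 2 / (muy * s).
have k0 : 0 < k by rewrite addr_gt0// divr_gt0// mulr_gt0.
have ms0 : 0 < muy * s by rewrite mulr_gt0.
have decay T : D T <= C * k ^- T * D 0%N.
  have := energy_pce_dm lipf cvxf ccvf sadf muy0 adm alphaE rhoE iter T.
  have v0 : v 0%N = 0 by case: iter.
  rewrite {}v0 -/k => le1.
  have le2 := le_trans le1 (energy_start lipf cvxf ccvf sadf muy0 adm (x 0%N) (y 0%N)).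
  have le3 := energy_coercive lipf cvxf ccvf sadf muy0 adm (x T) (y T) (v T).
  rewrite -/(D _) in le2 le3.
  have kT : 0 < k ^+ T by rewrite exprn_gt0.
  have le4 : k ^+ T * (s ^+ 2 / 32 * D T) <= L ^+ 2 * D 0%N.
    by apply: le_trans le2; rewrite ler_wpM2l// ltW.
  (* The energy bounds give the constant [32 * L ^+ 2 / s ^+ 2]; [muy <= s] relaxes it to [C]. *)
  have le5 : muy * s * (k ^+ T * D T) <= s ^+ 2 * (k ^+ T * D T).
    by rewrite ler_wpM2r ?mulr_ge0 ?D0 ?(ltW kT)// expr2 ler_wpM2r// ltW.
  rewrite [leRHS](_ : _ = (32 * L ^+ 2 * D 0%N) / (muy * s * k ^+ T)); last first.
    by rewrite /C; field; rewrite !gt_eqF.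
  by rewrite ler_pdivlMr ?mulr_gt0//; lra.
split=> [//|eps eps0 eps1 T].
have hs0 : 0 < h * s by rewrite mulr_gt0.
have C0 : 0 < C by rewrite divr_gt0// mulr_gt0// exprn_gt0.
rewrite (_ : 32 * L ^+ 2 / (muy * s * eps) = C / eps); last first.
  by rewrite /C; field; rewrite !gt_eqF.
rewrite mulrAC ler_pdivrMr// => lnT.
apply: le_trans (decay T) _; rewrite ler_wpM2r//.
rewrite ler_pdivrMr ?exprn_gt0// mulrC -ler_pdivrMr//.
rewrite -[C / eps]lnK ?posrE; last exact: divr_gt0.
(* Halving the rate [h * s / 16] replaces [k] by an exponential, whence the factor 32 in the bound
   on [T]. *)
have expk : expR (h * s / 32) <= k.
  rewrite (_ : k = 1 + 2 * (h * s / 32)); last by rewrite /k; field.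
  apply: expR_le_1D2x; apply/andP; split; first by rewrite divr_ge0// ltW.
  have : h * s <= h * L by rewrite ler_wpM2l ?(ltW h0)//; lra.
  lra.
apply: (@le_trans _ _ (expR (h * s / 32) ^+ T)); last first.
  by rewrite lerXn2r ?nnegrE ?expR_ge0 ?(ltW k0).
by rewrite -expRM_natl ler_expR; lra.
Qed.
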